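(* Let $\mathcal{S}\in\mathbb{M}$ be a background model with $\langle\mathcal{L}_{\gtrdot};\mathcal{L}_{\lessdot}\rangle\subseteq\mathcal{S}\subset\langle\mathcal{L}_{\geq};\mathcal{L}_{\leq}\rangle$, let $\underline{P}$ be a lower prevision on a set $\mathcal{K}\subseteq\mathcal{L}$, and let $\mathcal{M}_{\underline{P}}$ be the corresponding model, i.e., the natural extension of the assessment $\langle\mathcal{G}_{\underline{P}}+\mathbb{R}_{>0};\emptyset\rangle$. Then $\mathcal{M}_{\underline{P}}$ avoids confusion if and only if $\underline{P}$ avoids sure loss, i.e., $\inf_{g\in\operatorname{posi}\mathcal{G}_{\underline{P}}}\sup g\geq0$. In that case $$\mathcal{M}_{\underline{P}}=\langle\operatorname{posi}\mathcal{G}_{\underline{P}}+\mathcal{L}_{\gtrdot};\ \mathcal{L}_{\lessdot}-\operatorname{posi}\mathcal{G}_{\underline{P}}\rangle\cup\mathcal{S}.$$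
   Context: Let $\Omega$ be a non-empty set and let $\mathcal{L}$ be a real linear subspace of the vector space of all real-valued functions (''gambles'') on $\Omega$ with pointwise operations; $\mathcal{L}$ is assumed to contain the constant gambles, which are identified with their constant values. Put $\mathcal{L}_{\gtrdot}=\{f\in\mathcal{L}:\inf f>0\}$, $\mathcal{L}_{\lessdot}=\{f\in\mathcal{L}:\sup f<0\}$, $\mathcal{L}_{\geq}=\{f\in\mathcal{L}:\inf f\geq0\}$, $\mathcal{L}_{\leq}=\{f\in\mathcal{L}:\sup f\leq0\}$. A lower prevision on $\mathcal{K}\subseteq\mathcal{L}$ is a map $\underline{P}:\mathcal{K}\to\mathbb{R}$; its set of marginal gambles is $\mathcal{G}_{\underline{P}}=\{f-\underline{P}f:f\in\mathcal{K}\}$. For $\mathcal{H},\mathcal{H}'\subseteq\mathcal{L}$: $\mathcal{H}\pm\mathcal{H}'=\{f\pm g:f\in\mathcal{H},g\in\mathcal{H}'\}$ (empty if either is empty); $\overline{\mathcal{H}}=\{\lambda f:\lambda>0,f\in\mathcal{H}\}$; $\operatorname{posi}\mathcal{H}$ is the set of all linear combinations with strictly positive coefficients of non-empty finite families of elements of $\mathcal{H}$ (so $\operatorname{posi}\emptyset=\emptyset$). A cone is a set $\mathcal{H}\subseteq\mathcal{L}$ with $\operatorname{posi}\mathcal{H}=\mathcal{H}$. An assessment is a pair $\mathcal{A}=\langle\mathcal{A}_{\mathrm{acc}};\mathcal{A}_{\mathrm{rej}}\rangle$ of subsets of $\mathcal{L}$; inclusion, union and intersection are component-wise, $\subset$ is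 strict inclusion of pairs, and the intersection of the empty family of assessments is $\langle\mathcal{L};\mathcal{L}\rangle$. An assessment $\mathcal{A}$ avoids confusion if $\mathcal{A}_{\mathrm{acc}}\cap\mathcal{A}_{\mathrm{rej}}=\emptyset$. A model without confusion is an assessment $\mathcal{M}$ that avoids confusion, such that $\mathcal{M}_{\mathrm{acc}}$ is a cone and $\overline{\mathcal{M}_{\mathrm{rej}}}\cup(\overline{\mathcal{M}_{\mathrm{rej}}}-\mathcal{M}_{\mathrm{acc}})\subseteq\mathcal{M}_{\mathrm{rej}}$; the set of these is $\mathbb{M}$. The natural extension of an assessment $\mathcal{A}$ (relative to $\mathcal{S}$) is the intersection of all $\mathcal{M}\in\mathbb{M}$ with $\mathcal{A}\cup\mathcal{S}\subseteq\mathcal{M}$. *)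

(* Defs.v *)
From HB Require Import structures.
From mathcomp Require Import all_boot all_order all_algebra.
From mathcomp Require Import all_classical all_reals.
From mathcomp Require Import ereal topology normedtype.

Set Implicit Arguments.
Unset Strict Implicit.
Unset Printing Implicit Defensive.

Import Order.TTheory GRing.Theory Num.Theory.
Import numFieldNormedType.Exports.

Local Open Scope classical_set_scope.
Local Open Scope ring_scope.

(* A gamble on Omega is a function Omega -> R with the pointwise module structure;
   it may be unbounded, so infima and suprema are taken in the extended reals. *)
Definition gsup (R : realType) (Omega : Type) (f : Omega -> R) : \bar R :=
  ereal_sup (range (fun w => (f w)%:E)).

Definition ginf (R : realType) (Omega : Type) (f : Omega -> R) : \bar R :=
  ereal_inf (range (fun w => (f w)%:E)).

Definition gamble_space (R : realType) (Omega : Type)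
    (L : set (Omega -> R)) : Prop :=
  submod_closed (V := Omega -> R) (mem L) /\ forall c : R, L (cst c).

Definition gambles_gt0 (R : realType) (Omega : Type)
    (L : set (Omega -> R)) : set (Omega -> R) :=
  [set f | L f /\ (0 < ginf f)%E].

Definition gambles_lt0 (R : realType) (Omega : Type)
    (L : set (Omega -> R)) : set (Omega -> R) :=
  [set f | L f /\ (gsup f < 0)%E].

Definition gambles_ge0 (R : realType) (Omega : Type)
    (L : set (Omega -> R)) : set (Omega -> R) :=
  [set f | L f /\ (0 <= ginf f)%E].

Definition gambles_le0 (R : realType) (Omega : Type)
    (L : set (Omega -> R)) : set (Omega -> R) :=
  [set f | L f /\ (gsup f <= 0)%E].

Definition pos_consts (R : realType) (Omega : Type) : set (Omega -> R) :=
  [set cst c | c in [set c : R | 0 < c]].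

Definition set_add (V : zmodType) (H H' : set V) : set V :=
  [set f + g | f in H & g in H'].

Definition set_sub (V : zmodType) (H H' : set V) : set V :=
  [set f - g | f in H & g in H'].

Definition pos_scalings (R : realType) (V : lmodType R) (H : set V) : set V :=
  [set l *: f | l in [set l : R | 0 < l] & f in H].

Definition posi (R : realType) (V : lmodType R) (H : set V) : set V :=
  [set h | exists n (l : 'I_n.+1 -> R) (f : 'I_n.+1 -> V),
     [/\ forall i, 0 < l i, forall i, H (f i) & h = \sum_i l i *: f i]].

Definition cone (R : realType) (V : lmodType R) (H : set V) : Prop :=
  posi H = H.

Record assessment (V : Type) := Assessment { acc : set V; rej : set V }.

Definition assess_on (V : Type) (L : set V) (A : assessment V) : Prop :=
  acc A `<=` L /\ rej A `<=` L.

Definition assess_sub (V : Type) (A B : assessment V) : Prop :=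
  acc A `<=` acc B /\ rej A `<=` rej B.

Definition assess_proper (V : Type) (A B : assessment V) : Prop :=
  assess_sub A B /\ ~ assess_sub B A.

Definition assess_union (V : Type) (A B : assessment V) : assessment V :=
  Assessment (acc A `|` acc B) (rej A `|` rej B).

(* Intersecting with L makes the intersection of the empty family <L; L>, and
   changes nothing for a non-empty family of assessments on L. *)
Definition assess_bigcap (V : Type) (L : set V) (F : set (assessment V)) :
    assessment V :=
  Assessment (L `&` \bigcap_(A in F) acc A) (L `&` \bigcap_(A in F) rej A).

Definition avoids_confusion (V : Type) (A : assessment V) : Prop :=
  acc A `&` rej A = set0.

Definition models (R : realType) (V : lmodType R) (L : set V) :
    set (assessment V) :=
  [set M | [/\ assess_on L M, avoids_confusion M, cone (acc M) &
     pos_scalings (rej M) `|` set_sub (pos_scalings (rej M)) (acc M)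
       `<=` rej M]].

Definition natural_extension (R : realType) (V : lmodType R) (L : set V)
    (S A : assessment V) : assessment V :=
  assess_bigcap L
    [set M | models L M /\ assess_sub (assess_union A S) M].

Definition marginal_gambles (R : realType) (Omega : Type)
    (K : set (Omega -> R)) (P : K -> R) : set (Omega -> R) :=
  range (fun f : K => \val f - cst (P f)).

Definition prevision_model (R : realType) (Omega : Type)
    (L : set (Omega -> R)) (S : assessment (Omega -> R))
    (K : set (Omega -> R)) (P : K -> R) : assessment (Omega -> R) :=
  natural_extension L S
    (Assessment (set_add (marginal_gambles P) (@pos_consts R Omega)) set0).

Definition avoids_sure_loss (R : realType) (Omega : Type)
    (K : set (Omega -> R)) (P : K -> R) : Prop :=
  (0 <= ereal_inf [set gsup g | g in posi (marginal_gambles P)])%E.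

(* Main.v *)
Require Import Defs.
From HB Require Import structures.
From mathcomp Require Import all_boot all_order all_algebra.
From mathcomp Require Import all_classical all_reals.
From mathcomp Require Import ereal topology normedtype.

Set Implicit Arguments.
Unset Strict Implicit.
Unset Printing Implicit Defensive.

Import Order.TTheory GRing.Theory Num.Theory.
Import numFieldNormedType.Exports.

Local Open Scope classical_set_scope.
Local Open Scope ring_scope.

(** Write [G] for the cone [posi (marginal_gambles P)]. Sure loss means exactly
    that [G] meets [gambles_lt0 L] ([avoids_sure_lossP]).

    Every model extending the assessment and [S] accepts [g + e] for all [g] in
    [G] and all constants [e > 0] ([posi_shift_acc]). As the infimum of a gamble
    of [gambles_gt0 L] is bounded away from 0, a small constant can be moved
    from it to [g]; hence such a model accepts [G + gambles_gt0 L] and rejects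
    [gambles_lt0 L - G] ([model_lower_bound]). If some [g] in [G] has a negative
    supremum, then [g + e] still has one for small [e], so it is both accepted
    and rejected by every such model, and the natural extension is confused.

    Conversely, absent sure loss, the announced union is itself a model
    ([lower_prevision_model]), hence the least one extending the assessment and
    [S] ([prevision_modelE]). Closure holds because adding a
    gamble of [acc S], which is nonnegative, or subtracting one of [rej S], which
    is nonpositive, keeps a gamble inside [gambles_gt0 L]. As [S] itself is not
    confused, any confusion would exhibit an element of [G] with a negative
    supremum. *)

(** * Positive hulls, cones and models *)

Section PositiveHull.
Context (R : realType) (V : lmodType R).
Implicit Types (H C : set V) (f g : V).

Lemma sub_posi H : H `<=` posi H.
Proof.
move=> f Hf; exists 0%N, (fun=> 1), (fun=> f).
by split=> //; rewrite big_ord1 scale1r.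
Qed.

Lemma posiD H f g : posi H f -> posi H g -> posi H (f + g).
Proof.
move=> [n [l [u [l0 Hu ->]]]] [m [k [v [k0 Hv ->]]]].
exists (n + m.+1)%N,
  (fun i : 'I_(n.+1 + m.+1) =>
     match fintype.split i with inl a => l a | inr b => k b end),
  (fun i : 'I_(n.+1 + m.+1) =>
     match fintype.split i with inl a => u a | inr b => v b end).
split.
- by move=> i; case: fintype.split.
- by move=> i; case: fintype.split.
rewrite (@big_split_ord _ _ _ n.+1 m.+1) /=.
congr (_ + _); apply: eq_bigr => i _.
  by rewrite (unsplitK (inl i)).
by rewrite (unsplitK (inr i)).
Qed.

Lemma posiZ H (a : R) f : 0 < a -> posi H f -> posi H (a *: f).
Proof.
move=> a0 [n [l [u [l0 Hu ->]]]]; exists n, (fun i => a * l i), u.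
split=> [i|//|]; first exact: mulr_gt0.
by rewrite scaler_sumr; apply: eq_bigr => i _; rewrite scalerA.
Qed.

(** The positive hull is the least set that contains [H] and is closed under
    addition and positive scaling. *)
Lemma posi_least H C :
    (forall f g, C f -> C g -> C (f + g)) ->
    (forall (a : R) f, 0 < a -> C f -> C (a *: f)) ->
  H `<=` C -> posi H `<=` C.
Proof.
move=> CD CZ HC _ [n [l [u [l0 Hu ->]]]].
elim: n l u l0 Hu => [|n IH] l u l0 Hu.
  by rewrite big_ord1; apply: CZ => //; exact: HC.
rewrite big_ord_recl; apply: CD; first by apply: CZ => //; exact: HC.
by apply: IH.
Qed.

Lemma closed_cone C :
    (forall f g, C f -> C g -> C (f + g)) ->
    (forall (a : R) f, 0 < a -> C f -> C (a *: f)) ->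
  cone C.
Proof.
by move=> CD CZ; apply/seteqP; split; [exact: posi_least|exact: sub_posi].
Qed.

Lemma coneD C f g : cone C -> C f -> C g -> C (f + g).
Proof. by move=> <-; exact: posiD. Qed.

Lemma coneZ C (a : R) f : cone C -> 0 < a -> C f -> C (a *: f).
Proof. by move=> <-; exact: posiZ. Qed.

Lemma rej_modelZ (L : set V) M (a : R) f :
  models L M -> 0 < a -> rej M f -> rej M (a *: f).
Proof. by move=> [_ _ _ Mrej] a0 Mf; apply: Mrej; left; exists a => //; exists f. Qed.

Lemma rej_modelB (L : set V) M f g :
  models L M -> rej M f -> acc M g -> rej M (f - g).
Proof.
move=> [_ _ _ Mrej] Mf Mg; apply: Mrej; right; exists f; last by exists g.
by exists 1; [exact: ltr01|exists f => //; rewrite scale1r].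
Qed.

End PositiveHull.

(** * Gambles of constant sign *)

Section Gambles.
Context (R : realType) (Omega : Type) (L : set (Omega -> R)).
Implicit Types f g : Omega -> R.

Lemma ginf_ge (c : R) f : (c%:E <= ginf f)%E <-> forall w, c <= f w.
Proof.
split=> [cf w|cf]; last by apply: le_ereal_inf_tmp => _ [w _ <-]; rewrite lee_fin.
by rewrite -lee_fin (le_trans cf)//; apply: ereal_inf_lbound; exists w.
Qed.

Lemma gsupN f : gsup f = (- ginf (- f)%R)%E.
Proof. by rewrite /gsup ereal_supEN image_comp. Qed.

Lemma gambles_gt0P f :
  gambles_gt0 L f <-> L f /\ exists2 e : R, 0 < e & forall w, e <= f w.
Proof.
split=> -[Lf]; last first.
  move=> [e e0 /ginf_ge ef]; split=> //.
  by rewrite (lt_le_trans _ ef)// lte_fin.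
move=> f0; split=> //.
suff [e e0 /ginf_ge] : exists2 e : R, 0 < e & (e%:E <= ginf f)%E by exists e.
(* On an empty set of outcomes the infimum is infinite and any constant works. *)
case: (ginf f) f0 => [r r0|_|//]; first by exists r.
by exists 1 => //; rewrite leey.
Qed.

Lemma gambles_ge0P f : gambles_ge0 L f <-> L f /\ forall w, 0 <= f w.
Proof. by split=> -[Lf /ginf_ge]. Qed.

Context (L_space : gamble_space L).

Lemma gamble_spaceD f g : L f -> L g -> L (f + g).
Proof.
case: L_space => -[_ LZD] _ Lf Lg.
have := LZD 1 f g; rewrite !inE => /(_ Lf Lg).
by rewrite scale1r.
Qed.

Lemma gamble_spaceZ (a : R) f : L f -> L (a *: f).
Proof.
case: L_space => -[L0 LZD] _ Lf.
have := LZD a f 0; rewrite !inE => /(_ Lf).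
by rewrite addr0; apply; rewrite inE in L0.
Qed.

Lemma gamble_spaceN f : L f -> L (- f).
Proof. by rewrite -scaleN1r; exact: gamble_spaceZ. Qed.

Lemma gamble_spaceB f g : L f -> L g -> L (f - g).
Proof. by move=> Lf Lg; apply/gamble_spaceD/gamble_spaceN. Qed.

Lemma gamble_space_cst (c : R) : L (cst c).
Proof. by case: L_space => _; exact. Qed.

Lemma gambles_lt0N f : gambles_lt0 L f <-> gambles_gt0 L (- f).
Proof.
rewrite /gambles_lt0 /gambles_gt0 /= gsupN oppe_lt0.
by split=> -[Lf ?]; split=> //; [|rewrite -(opprK f)]; exact: gamble_spaceN.
Qed.

Lemma gambles_le0N f : gambles_le0 L f <-> gambles_ge0 L (- f).
Proof.
rewrite /gambles_le0 /gambles_ge0 /= gsupN oppe_le0.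
by split=> -[Lf ?]; split=> //; [|rewrite -(opprK f)]; exact: gamble_spaceN.
Qed.

Lemma gambles_gt0_ge0 f : gambles_gt0 L f -> gambles_ge0 L f.
Proof. by move=> [Lf /ltW]. Qed.

Lemma gambles_gt0D f g :
  gambles_gt0 L f -> gambles_ge0 L g -> gambles_gt0 L (f + g).
Proof.
move=> /gambles_gt0P[Lf [e e0 ef]] /gambles_ge0P[Lg g0].
apply/gambles_gt0P; split; first exact: gamble_spaceD.
by exists e => // w; rewrite -[e]addr0; exact: lerD.
Qed.

Lemma gambles_gt0Z (a : R) f :
  0 < a -> gambles_gt0 L f -> gambles_gt0 L (a *: f).
Proof.
move=> a0 /gambles_gt0P[Lf [e e0 ef]].
apply/gambles_gt0P; split; first exact: gamble_spaceZ.
by exists (a * e) => [|w]; [exact: mulr_gt0|exact: ler_wpM2l (ltW a0) _ _ (ef w)].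
Qed.

Lemma gambles_gt0_cst (c : R) : 0 < c -> gambles_gt0 L (cst c).
Proof.
move=> c0; apply/gambles_gt0P; split; first exact: gamble_space_cst.
by exists c.
Qed.

Lemma gambles_gt0_shrink f :
  gambles_gt0 L f -> exists2 e : R, 0 < e & gambles_gt0 L (f - cst e).
Proof.
move=> /gambles_gt0P[Lf [e e0 ef]]; exists (e / 2); first exact: divr_gt0.
apply/gambles_gt0P; split.
  exact: gamble_spaceB Lf (gamble_space_cst _).
exists (e / 2) => [|w]; first exact: divr_gt0.
by rewrite lerBrDr -splitr.
Qed.

(** * Marginal gambles and the models above an assessment *)

Context (K : set (Omega -> R)) (P : K -> R).
Local Notation G := (posi (marginal_gambles P)).

Lemma avoids_sure_lossP :
  avoids_sure_loss P <-> forall g, G g -> ~ (gsup g < 0)%E.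
Proof.
split=> [asl g Gg|noloss].
  apply/negP; rewrite -leNgt (le_trans asl)//.
  by apply: ereal_inf_lbound; exists g.
apply: le_ereal_inf_tmp => _ [g Gg <-].
by rewrite leNgt; apply/negP; exact: noloss.
Qed.

Lemma posi_marginal_sub : K `<=` L -> G `<=` L.
Proof.
move=> KL; apply: posi_least => [f g|a f _|_ [f _ <-]].
- exact: gamble_spaceD.
- exact: gamble_spaceZ.
- exact: gamble_spaceB (KL _ (set_valP f)) (gamble_space_cst _).
Qed.

(** The property that every positive shift of a gamble lies in the cone passes
    to sums and positive multiples: the shift is split into halves, or divided
    by the factor. *)
Lemma posi_shift_acc (C : set (Omega -> R)) :
    cone C -> set_add (marginal_gambles P) (@pos_consts R Omega) `<=` C ->
  forall g (e : R), G g -> 0 < e -> C (g + cst e).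
Proof.
move=> Ccone sub_C g e Gg; move: g Gg e.
apply: (@posi_least _ _ _ [set g | forall e : R, 0 < e -> C (g + cst e)]).
- move=> f g Cf Cg e e0.
  have -> : f + g + cst e = (f + cst (e / 2)) + (g + cst (e / 2)).
    by apply/funext => w; rewrite !fctE addrACA -splitr.
  by apply: (coneD Ccone); [apply: Cf|apply: Cg]; exact: divr_gt0.
- move=> a f a0 Cf e e0.
  have -> : a *: f + cst e = a *: (f + cst (e / a)).
    apply/funext => w; rewrite !fctE /= scalerDr; congr (_ + _).
    by rewrite /GRing.scale /= mulrC divfK// gt_eqF.
  by apply: (coneZ Ccone a0); apply: Cf; exact: divr_gt0.
- move=> f Gf e e0; apply: sub_C; exists f => //.
  by exists (cst e) => //; exists e.
Qed.

Context (S : assessment (Omega -> R)).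
Context (S_model : models L S)
  (S_lower : assess_sub (Assessment (gambles_gt0 L) (gambles_lt0 L)) S).

(* [A] is the assessment defined by [P], and [E] the candidate for its natural
   extension. *)
Local Notation A :=
  (Assessment (set_add (marginal_gambles P) (@pos_consts R Omega)) set0).
Local Notation E :=
  (assess_union
    (Assessment (set_add G (gambles_gt0 L)) (set_sub (gambles_lt0 L) G)) S).

Lemma model_lower_bound M :
  models L M -> assess_sub (assess_union A S) M -> assess_sub E M.
Proof.
move=> Mmod [accM rejM]; have [_ _ Mcone _] := Mmod.
have [S_gt0 S_lt0] := S_lower.
have shift := posi_shift_acc Mcone (subset_trans (@subsetUl _ _ _) accM).
split=> f [|Sf]; [|by apply: accM; right| |by apply: rejM; right].
- move=> [g Gg [h h0 <-]].
  have [e e0 he0] := gambles_gt0_shrink h0.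
  rewrite -(subrK (cst e) h) addrCA; apply: (coneD Mcone); last exact: shift.
  by apply: accM; right; exact: S_gt0.
- move=> [h /gambles_lt0N h0 [g Gg <-]].
  have [e e0 he0] := gambles_gt0_shrink h0.
  rewrite -(addrKA (cst e)) -[cst e + g]addrC.
  apply: (rej_modelB Mmod _ (shift _ _ Gg e0)).
  by apply: rejM; right; apply/S_lt0/gambles_lt0N; rewrite opprD.
Qed.

Context
  (S_upper : assess_sub S (Assessment (gambles_ge0 L) (gambles_le0 L))).

Lemma assessment_sub_extension : assess_sub (assess_union A S) E.
Proof.
split=> f [|Sf]; [|by right|by []|by right].
move=> [g Gg [_ [c c0 <-] <-]]; left; exists g; first exact: sub_posi.
by exists (cst c) => //; exact: gambles_gt0_cst.
Qed.

Lemma lower_prevision_model : K `<=` L -> avoids_sure_loss P -> models L E.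
Proof.
move=> KL /avoids_sure_lossP noloss.
have GL := posi_marginal_sub KL.
have [[S_accL S_rejL] S_conf S_cone _] := S_model.
have [S_ge0 S_le0] := S_upper.
(* Every confusion outside [S] is reduced to a violation of this fact. *)
have no_loss g : G g -> ~ gambles_gt0 L (- g).
  by move=> Gg /gambles_lt0N[_]; exact: noloss.
have rej_ge0 r : rej S r -> gambles_ge0 L (- r).
  by move=> /S_le0 /gambles_le0N.
split.
- split=> f [|Sf].
  + by move=> [g Gg [h [Lh _] <-]]; apply: gamble_spaceD => //; exact: GL.
  + exact: S_accL.
  + by move=> [h [Lh _] [g Gg <-]]; apply: gamble_spaceB => //; exact: GL.
  + exact: S_rejL.
- apply/seteqP; split=> // f [[[g Gg [h h0 <-]]|Sf]].
  + move=> [[h' /gambles_lt0N h'0 [g' Gg' eq_f]]|Srej].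
    * apply: (no_loss (g + g')); first exact: posiD.
      suff -> : - (g + g') = h - h'.
        by apply: gambles_gt0D => //; exact: gambles_gt0_ge0.
      by rewrite -(subrK g' h') eq_f !opprD addrA addrCA addrA addrK.
    * apply: (no_loss g) => //.
      suff -> : - g = h - (g + h) by apply: gambles_gt0D => //; exact: rej_ge0.
      by rewrite opprD addrCA subrr addr0.
  + move=> [[h /gambles_lt0N h0 [g Gg eq_f]]|Srej].
    * apply: (no_loss g) => //.
      suff -> : - g = - h + f by apply: gambles_gt0D => //; exact: S_ge0.
      by rewrite -eq_f addrA addNr add0r.
    * by suff : set0 f by []; rewrite -S_conf.
- apply: closed_cone => [f f' |a f a0].
  + move=> [[g Gg [h h0 <-]]|Sf] [[g' Gg' [h' h'0 <-]]|Sf'].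
    * left; exists (g + g'); first exact: posiD.
      exists (h + h'); last by rewrite addrACA.
      by apply: gambles_gt0D => //; exact: gambles_gt0_ge0.
    * left; exists g => //; exists (h + f'); last by rewrite addrA.
      by apply: gambles_gt0D => //; exact: S_ge0.
    * left; exists g' => //; exists (h' + f); last by rewrite addrA addrC.
      by apply: gambles_gt0D => //; exact: S_ge0.
    * by right; exact: coneD.
  + move=> [[g Gg [h h0 <-]]|Sf]; last by right; exact: coneZ.
    left; exists (a *: g); first exact: posiZ.
    by exists (a *: h); [exact: gambles_gt0Z|rewrite scalerDr].
- have rejZ : pos_scalings (rej E) `<=` rej E.
    move=> _ [a a0 [f Ef <-]].
    case: Ef => [[h /gambles_lt0N h0 [g Gg <-]]|Sf]; last first.
      by right; exact: rej_modelZ S_model a0 Sf.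
    left; exists (a *: h).
      by apply/gambles_lt0N; rewrite -scalerN; exact: gambles_gt0Z.
    by exists (a *: g); [exact: posiZ|rewrite scalerBr].
  rewrite subUset; split=> // _ [r /rejZ Er [f Ef <-]].
  case: Er Ef => [[h /gambles_lt0N h0 [g Gg <-]]|Sr] [[g' Gg' [h' h'0 <-]]|Sf].
  + left; exists (h - h').
      apply/gambles_lt0N; rewrite opprB addrC.
      by apply: gambles_gt0D => //; exact: gambles_gt0_ge0.
    exists (g + g'); first exact: posiD.
    by rewrite opprD addrACA -opprD [h' + _]addrC.
  + left; exists (h - f); last by exists g => //; rewrite addrAC.
    apply/gambles_lt0N; rewrite opprB addrC.
    by apply: gambles_gt0D => //; exact: S_ge0.
  + left; exists (r - h'); last by exists g' => //; rewrite opprD addrAC addrA.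
    apply/gambles_lt0N; rewrite opprB.
    by apply: gambles_gt0D => //; exact: rej_ge0.
  + by right; exact: rej_modelB S_model Sr Sf.
Qed.

Lemma prevision_modelE :
  K `<=` L -> avoids_sure_loss P -> prevision_model L S P = E.
Proof.
move=> KL asl; have Emod := lower_prevision_model KL asl.
have [[E_accL E_rejL] _ _ _] := Emod.
rewrite /prevision_model /natural_extension /assess_bigcap.
congr Assessment; apply/seteqP; split.
- by move=> f [_ /(_ E)]; apply; split=> //; exact: assessment_sub_extension.
- move=> f Ef; split; first exact: E_accL.
  by move=> M [Mmod /(model_lower_bound Mmod)[accM _]]; exact: accM.
- by move=> f [_ /(_ E)]; apply; split=> //; exact: assessment_sub_extension.
- move=> f Ef; split; first exact: E_rejL.
  by move=> M [Mmod /(model_lower_bound Mmod)[_ rejM]]; exact: rejM.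
Qed.

(** The gamble that witnesses confusion lies in [L], so the argument also covers
    the case where no model extends the assessment and the natural extension is
    the pair of [L] with itself. *)
Lemma avoids_confusion_avoids_sure_loss :
  K `<=` L -> avoids_confusion (prevision_model L S P) -> avoids_sure_loss P.
Proof.
move=> KL noconf; apply/avoids_sure_lossP => g Gg g0.
have Lg := posi_marginal_sub KL Gg.
have /gambles_lt0N/gambles_gt0_shrink[e e0 ge0] : gambles_lt0 L g by [].
have Lge : L (g + cst e) by apply: gamble_spaceD Lg (gamble_space_cst _).
suff : set0 (g + cst e) by [].
rewrite -noconf; split; split=> // M [[_ _ Mcone _] [accM rejM]].
- by apply: (posi_shift_acc Mcone _ Gg e0) => f Af; apply: accM; left.
- apply: rejM; right; have [_] := S_lower; apply.
  by apply/gambles_lt0N; rewrite opprD.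
Qed.

End Gambles.

Theorem theorem5p5 (R : realType) (Omega : Type) (L : set (Omega -> R))
    (S : assessment (Omega -> R)) (K : set (Omega -> R)) (P : K -> R)
    (Omega_nonempty : [set: Omega] !=set0)
    (L_space : gamble_space L)
    (S_model : models L S)
    (S_lower : assess_sub (Assessment (gambles_gt0 L) (gambles_lt0 L)) S)
    (S_upper : assess_proper S (Assessment (gambles_ge0 L) (gambles_le0 L)))
    (K_sub : K `<=` L) :
  (avoids_confusion (prevision_model L S P) <-> avoids_sure_loss P) /\
  (avoids_sure_loss P ->
   prevision_model L S P =
   assess_union
     (Assessment
        (set_add (posi (marginal_gambles P)) (gambles_gt0 L))
        (set_sub (gambles_lt0 L) (posi (marginal_gambles P))))
     S).
Proof.
have [S_le _] := S_upper.
split; last exact: prevision_modelE.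
split; first exact: avoids_confusion_avoids_sure_loss.
move=> asl; rewrite (prevision_modelE L_space S_model S_lower S_le K_sub asl).
by have [] := lower_prevision_model L_space S_model S_le K_sub asl.
Qed.
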